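(* Let $(f_i:\underline{X}_i\to\underline{Y}_i)_{i\in I}$ be any set-indexed family of functions between topological spaces. Then $\lceil f_i\rceil_{i\in I}$ is a least upper bound of $\{f_i\mid i\in I\}$ with respect to $\leq_2$: $f_j\leq_2\lceil f_i\rceil_{i\in I}$ for every $j\in I$, and whenever $g$ is a function between topological spaces with $f_i\leq_2 g$ for all $i\in I$, then $\lceil f_i\rceil_{i\in I}\leq_2 g$. Consequently $(\mathbb{F}_2,\leq_2)$ is a complete join-semilattice, and the supremum of a set $S$ of elements is the equivalence class of $\lceil f\rceil_{f\in S}$ (taking representatives).
   Context: A partial function $F:\subseteq X\to Y$ is a function from a subset $\operatorname{dom}(F)\subseteq X$ to $Y$; between topological spaces it is called continuous if it is continuous on $\operatorname{dom}(F)$ with the subspace topology. For (total) functions $f:\underline{X}_1\to\underline{Y}_1$ and $g:\underline{X}_2\to\underline{Y}_2$ between topological spaces, $f\leq_2 g$ means: there are continuous partial functions $F:\subseteq \underline{X}_1\times\underline{Y}_2\to\underline{Y}_1$ (product topology) and $G:\subseteq\underline{X}_1\to\underline{X}_2$ such that for all $x\in X_1$, $G(x)$ and $F(x,g(G(x)))$ are defined and $f(x)=F(x,g(G(x)))$. $\leq_2$ is a preorder; $\mathbb{F}_2$ denotes the class of its equivalence classes of functions between topological spaces, partially ordered by $\leq_2$. The coproduct $\coprod_{i\in I}\underline{X}_i$ is the set $\bigcup_{i\in I}\{i\}\times X_i$ with the smallest topology containing all sets $\{i\}\times U$, $U$ open in $\underline{X}_i$. For functions $f_i:\underline{X}_i\to\underline{Y}_i$,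 $\lceil f_i\rceil_{i\in I}:\coprod_{i\in I}\underline{X}_i\to\coprod_{i\in I}\underline{Y}_i$ is defined by $\lceil f_i\rceil_{i\in I}(i,x)=(i,f_i(x))$. A partially ordered class is a complete join-semilattice if every subset (of any cardinality) has a least upper bound. *)

(* Defs.v *)
From HB Require Import structures.
From mathcomp Require Import all_boot all_classical topology.

Set Implicit Arguments.
Unset Strict Implicit.
Unset Printing Implicit Defensive.

Local Open Scope classical_set_scope.

(* Values are only attached to points of the domain (and not, say, given by a
   total function with junk values), so that Y may be empty. *)
Record partial_fun (X Y : Type) := PartialFun {
  pdom : set X;
  pval :> pdom -> Y }.
Arguments pdom {X Y} _.
Arguments pval {X Y} _ _.

(* [set_type (pdom F)] carries the library's subspace topology. *)
Definition pcontinuous (X Y : topologicalType) (F : partial_fun X Y) : Prop :=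
  continuous (pval F).

Definition leq2 (X1 Y1 X2 Y2 : topologicalType)
    (f : X1 -> Y1) (g : X2 -> Y2) : Prop :=
  exists (F : partial_fun (X1 * Y2)%type Y1) (G : partial_fun X1 X2),
    [/\ pcontinuous F, pcontinuous G &
      forall x : X1,
        exists (Gx : x \in pdom G)
               (Fx : (x, g (G (exist _ x Gx))) \in pdom F),
          f x = F (exist _ (x, g (G (exist _ x Gx))) Fx)].

(* The coproduct of a family of spaces is the library's topology on
   [{i & X i}]; it is the smallest one containing all {i} x U, U open. *)
Lemma coprod_topology_smallest (I : choiceType) (X : I -> topologicalType) :
  (forall i (U : set (X i)), open U -> open (existT X i @` U)) /\
  forall O : set (set {i & X i}),
    O setT ->
    (forall A B, O A -> O B -> O (A `&` B)) ->
    (forall (K : Type) (A : K -> set {i & X i}),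
       (forall k, O (A k)) -> O (\bigcup_k A k)) ->
    (forall i (U : set (X i)), open U -> O (existT X i @` U)) ->
    forall A : set {i & X i}, open A -> O A.
Proof.
split=> [i U oU|O _ _ OU OX A /sigT_openP oA]; first exact: existT_open_map.
have -> : A = \bigcup_i (existT X i @` (existT X i @^-1` A)).
  apply/seteqP; split=> [[i x] Ax|_ [i _ [x Ax <-]]//].
  by exists i => //; exists x.
by apply: OU => i; apply: OX; exact: oA.
Qed.

Definition coprod_fun (I : choiceType) (X Y : I -> topologicalType)
    (f : forall i, X i -> Y i) (p : {i & X i}) : {i & Y i} :=
  existT Y (projT1 p) (f (projT1 p) (projT2 p)).

Record topfun := TopFun {
  tdom : topologicalType;
  tcod : topologicalType;
  tfun :> tdom -> tcod }.
Arguments tfun _ _ : clear implicits.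

Definition equiv2 (f g : topfun) : Prop := leq2 f g /\ leq2 g f.

Definition coprod_topfun (I : choiceType) (f : I -> topfun) : topfun :=
  TopFun (coprod_fun (fun i => tfun (f i))).

(* The plain arrow [topfun -> Prop] is used for classes of functions: [topfun]
   lives one universe above the spaces. *)
Definition F2 : Type :=
  {C : topfun -> Prop | exists f : topfun, C = equiv2 f}.

Definition F2_class (f : topfun) : F2 :=
  exist _ (equiv2 f) (ex_intro _ f erefl).

Definition F2_le (c d : F2) : Prop :=
  exists f g : topfun, [/\ proj1_sig c f, proj1_sig d g & leq2 f g].

Definition is_partial_order (A : Type) (le : A -> A -> Prop) : Prop :=
  [/\ forall a, le a a,
      forall a b, le a b -> le b a -> a = b &
      forall a b c, le a b -> le b c -> le a c].

Definition is_lub (A : Type) (le : A -> A -> Prop) (S : A -> Prop) (s : A) :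
    Prop :=
  (forall a, S a -> le a s) /\ (forall b, (forall a, S a -> le a b) -> le s b).

(* A subclass is a set when it is the range of a family indexed by a type in
   the universe of the carriers of topological spaces. *)
Definition is_set (A : Type) (S : A -> Prop) : Prop :=
  exists (I : choiceType) (e : I -> A), forall a, S a <-> exists i, e i = a.

Definition is_complete_join_semilattice (A : Type) (le : A -> A -> Prop) :
    Prop :=
  is_partial_order le /\
  forall S : A -> Prop, is_set S -> exists s, is_lub le S s.

(* Main.v *)
Require Import Defs.
From HB Require Import structures.
From mathcomp Require Import all_boot all_classical topology.

(** The domain of [G] is everything, and only the values of [F] at the points
    [(x, g (G x))] matter; hence [f <=_2 g] says that, for some continuous
    total [G], [f] is continuous for the initial topology of the map
    [x |-> (x, g (G x))].  In this form, reductions [G i] of the summands to a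
    common [g] glue to a reduction of the coproduct, because the summands are
    open, and conversely a summand reduces to the coproduct along its
    inclusion. *)

Set Implicit Arguments.
Unset Strict Implicit.
Unset Printing Implicit Defensive.

Local Open Scope classical_set_scope.

(** Open sets of the subspace are preimages of ambient ones under [\val], so continuity of a partial
    function can be tested with ambient neighbourhoods. *)
Lemma nbhs_set_typeP (T : topologicalType) (A : set T) (a : A) (U : set A) :
  nbhs a U <->
  exists2 V, nbhs (\val a) V & forall b : A, V (\val b) -> U b.
Proof.
split=> [[_ [[V oV <-]] Va VU]|[V nV VU]].
  by exists V; [exact: open_nbhs_nbhs | exact: VU].
have nVA : nbhs a (set_val @^-1` V) by exact: initial_continuous.
by apply: filterS nVA => b; exact: VU.
Qed.

Lemma leq2P (X1 Y1 X2 Y2 : topologicalType) (f : X1 -> Y1) (g : X2 -> Y2) :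
  leq2 f g <->
  exists2 G : X1 -> X2, continuous G &
    forall x U, nbhs (f x) U ->
      exists A B, [/\ nbhs x A, nbhs (g (G x)) B &
        forall x', A x' -> B (g (G x')) -> U (f x')].
Proof.
split=> [[F [G [cF cG FG]]]|[G cG fG]].
  (* [FG x] brings its own membership proofs; as proofs of boolean equations they can be exchanged
     for the uniform [domG x] and [domF x]. *)
  have domG x : x \in pdom G by have [] := FG x.
  pose G' x := G (exist _ x (domG x)).
  have domF x : (x, g (G' x)) \in pdom F.
    have [Gx [Fx _]] := FG x.
    by rewrite /G' (bool_irrelevance (domG x) Gx).
  have fE x : f x = F (exist _ (x, g (G' x)) (domF x)).
    have [Gx [Fx ->]] := FG x; congr (pval F _); apply/eq_exist.
    by rewrite /G' (bool_irrelevance (domG x) Gx).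
  exists G' => [x U /cG/nbhs_set_typeP[V nV VU]|x U].
    by apply: filterS nV => x' Vx'; exact: (VU (exist _ x' (domG x'))).
  rewrite fE => /cF/nbhs_set_typeP[V [[A B] /= [nA nB] ABV] VU].
  exists A, B; split=> // x' Ax' Bx'; rewrite fE.
  exact/(VU (exist _ (x', g (G' x')) (domF x')))/ABV.
(* [F] lives on the points [(x, g (G x))] alone and reads [x] off the first coordinate; its
   continuity on [D] is then the hypothesis [fG]. *)
pose D : set (X1 * Y2) := range (fun x => (x, g (G x))).
exists (PartialFun (fun p : D => f (\val p).1)).
exists (PartialFun (fun x : [set: X1] => G (\val x))).
split=> [[p Dp] U /= nU|x U /= /cG nU|x].
- move: nU; have /set_mem[x _ px] := Dp.
  rewrite -{1}px /= => /fG[A [B [nA nB ABU]]].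
  apply/nbhs_set_typeP; exists (A `*` B) => [|[q Dq] /= [Aq Bq]].
    by rewrite /= -px; exists (A, B).
  have /set_mem[y _ yq] := Dq.
  by apply: ABU => //; move: Bq; rewrite -yq.
- by apply/nbhs_set_typeP; exists (G @^-1` U).
- exists (mem_set I) => /=.
  by have Dx : (x, g (G x)) \in D; [apply/mem_set; exists x | exists Dx].
Qed.

Lemma leq2_refl (X Y : topologicalType) (f : X -> Y) : leq2 f f.
Proof.
apply/leq2P; exists id => [x|x U nU]; first exact: cvg_id.
by exists setT, U; split=> //; exact: filterT.
Qed.

Lemma leq2_trans (X1 Y1 X2 Y2 X3 Y3 : topologicalType)
    (f : X1 -> Y1) (g : X2 -> Y2) (h : X3 -> Y3) :
  leq2 f g -> leq2 g h -> leq2 f h.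
Proof.
move=> /leq2P[G cG fG] /leq2P[H cH gH]; apply/leq2P.
exists (H \o G) => [x|x U /fG[A [B [nA /gH[C [D [nC nD CDB]]] ABU]]]].
  by apply: continuous_comp; [exact: cG | exact: cH].
(* [C] is a neighbourhood of [G x], hence pulled back along [G]; together with [D] it forces
   [g (G x')] into [B]. *)
exists (A `&` G @^-1` C), D; split=> //.
  by apply: filterI => //; exact: cG.
by move=> x' [Ax' Cx'] Dx'; apply: ABU => //; exact: CDB.
Qed.

Lemma leq2_coprod_fun (I : choiceType) (X Y : I -> topologicalType)
    (f : forall i, X i -> Y i) j :
  leq2 (f j) (coprod_fun f).
Proof.
apply/leq2P; exists (existT X j) => [|x U nU]; first exact: existT_continuous.
(* The inclusion of a summand is open, and its injectivity leads back from the image to [U]. *)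
exists setT, (existT Y j @` U); split; first exact: filterT.
  exact: existT_nbhs.
move=> x' _ [y Uy /eqP]; rewrite eq_Tagged => /eqP <-.
exact: Uy.
Qed.

Lemma coprod_fun_leq2 (I : choiceType) (X Y : I -> topologicalType)
    (f : forall i, X i -> Y i) (Z W : topologicalType) (g : Z -> W) :
  (forall i, leq2 (f i) g) -> leq2 (coprod_fun f) g.
Proof.
move=> fg.
have /all_sig2[G cG fG] i := cid2 ((leq2P (f i) g).1 (fg i)).
apply/leq2P; exists (fun p => G (projT1 p) (projT2 p)) => [|[i x] U].
  exact: sigT_continuous.
move=> /fG[A [B [nA nB ABU]]].
(* Inside the summand [i], all points near [(i, x)] are sent by the same [G i]. *)
exists (existT X i @` A), B; split=> //; first exact: existT_nbhs.
by move=> _ [x' Ax' <-]; exact: ABU.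
Qed.

Lemma F2_classP (c : F2) : exists f, F2_class f = c.
Proof. by case: c => C [f fC]; exists f; exact/eq_exist. Qed.

(** [F2_le] asks for one comparable pair of representatives; transitivity carries the comparison to
    any other pair. *)
Lemma F2_le_class (f g : topfun) : F2_le (F2_class f) (F2_class g) <-> leq2 f g.
Proof.
split=> [[f' [g' [[ff' _] [_ g'g] f'g']]]|fg].
  exact: leq2_trans ff' (leq2_trans f'g' g'g).
by exists f, g; split=> //; split; exact: leq2_refl.
Qed.

Lemma F2_class_eq (f g : topfun) :
  leq2 f g -> leq2 g f -> F2_class f = F2_class g.
Proof.
move=> fg gf; apply/eq_exist/funext => h; apply/propext.
by split=> -[? ?]; split; apply: leq2_trans; eassumption.
Qed.

Lemma F2_le_partial_order : is_partial_order F2_le.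
Proof.
split=> [a|a b|a b c].
- by have [f <-] := F2_classP a; apply/F2_le_class; exact: leq2_refl.
- have [f <-] := F2_classP a; have [g <-] := F2_classP b.
  by move=> /F2_le_class fg /F2_le_class gf; exact: F2_class_eq.
- have [f <-] := F2_classP a; have [g <-] := F2_classP b.
  have [h <-] := F2_classP c => /F2_le_class fg /F2_le_class gh.
  by apply/F2_le_class; exact: leq2_trans gh.
Qed.

(** The family may hit a class repeatedly: the bounds only involve which classes occur. *)
Lemma coprod_topfun_is_lub (S : F2 -> Prop) (J : choiceType) (f : J -> topfun) :
  (forall c, S c <-> exists j, F2_class (f j) = c) ->
  is_lub F2_le S (F2_class (coprod_topfun f)).
Proof.
move=> SE; split=> [_ /SE[j <-]|b].
  exact/F2_le_class/(leq2_coprod_fun (fun i => tfun (f i))).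
have [g <-] := F2_classP b => ub; apply/F2_le_class/coprod_fun_leq2 => j.
by apply/F2_le_class/ub/SE; exists j.
Qed.

Theorem theorem4p4 :
  (forall (I : choiceType) (X Y : I -> topologicalType)
          (f : forall i : I, X i -> Y i),
     (forall j : I, leq2 (f j) (coprod_fun f)) /\
     (forall (Z W : topologicalType) (g : Z -> W),
        (forall i : I, leq2 (f i) g) -> leq2 (coprod_fun f) g)) /\
  is_complete_join_semilattice F2_le /\
  (forall (S : F2 -> Prop) (J : choiceType) (f : J -> topfun),
     (forall c : F2, S c <-> exists j : J, F2_class (f j) = c) ->
     is_lub F2_le S (F2_class (coprod_topfun f))).
Proof.
split=> [I X Y f|].
  by split=> [j|Z W g]; [exact: leq2_coprod_fun | exact: coprod_fun_leq2].
split; last exact: coprod_topfun_is_lub.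
split=> [|S [I [e Se]]]; first exact: F2_le_partial_order.
(* Choice of a representative in each class [e i]. *)
have [f fe] := choice (fun i => F2_classP (e i)).
exists (F2_class (coprod_topfun f)); apply: coprod_topfun_is_lub => c.
by rewrite Se; split=> -[i <-]; exists i; rewrite fe.
Qed.
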